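(* Let $(X,d)$ be an uncountable Lindelöf metric space and let $\phi_n:X\to X$, $n=1,2,\ldots$, be a sequence of continuous maps such that the non-autonomous system $(X,\phi_{1,\infty})$ is equicontinuous. Then $(X,\phi_{1,\infty})$ is not $\aleph_0$-expansive.
   Context: For a sequence of continuous maps $\phi_{1,\infty}=\{\phi_n\}_{n=1}^\infty$ on $X$, write $\phi_1^n=\phi_n\circ\phi_{n-1}\circ\cdots\circ\phi_1$ for $n\ge 1$; here $\mathbb{N}=\{1,2,\ldots\}$. The system $(X,\phi_{1,\infty})$ is equicontinuous if for every $x_0\in X$ and every $\epsilon>0$ there is $\delta>0$ such that $d(\phi_1^n(x_0),\phi_1^n(y))<\epsilon$ for all $n>0$ whenever $d(y,x_0)<\delta$. The system is $\aleph_0$-expansive if there is $c>0$ such that for every $x\in X$ the set $\{y\in X: d(\phi_1^i(x),\phi_1^i(y))\le c\text{ for all } i\in\mathbb{N}\}$ is at most countable. *)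

(* Defs.v *)
From mathcomp Require Import all_boot all_order all_algebra.
From mathcomp Require Import all_classical all_reals all_analysis.

Set Implicit Arguments.
Unset Strict Implicit.
Unset Printing Implicit Defensive.

Import Order.TTheory GRing.Theory Num.Theory.

Local Open Scope classical_set_scope.
Local Open Scope ring_scope.

Definition lindelof_space (X : topologicalType) : Prop :=
  forall U : set (set X), (forall A, U A -> open A) -> \bigcup_(A in U) A = setT ->
  exists V : set (set X),
    [/\ V `<=` U, countable V & \bigcup_(A in V) A = setT].

(* The family phi_1, phi_2, ... is encoded as phi : nat -> X -> X; the value
   phi 0 is ignored. [orbit_map phi n] is phi_n o ... o phi_1, and
   [orbit_map phi 0] is the identity. *)
Fixpoint orbit_map (X : Type) (phi : nat -> X -> X) (n : nat) : X -> X :=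
  if n is m.+1 then phi m.+1 \o orbit_map phi m else id.

Definition equicontinuous_system (R : realType) (X : metricType R)
    (phi : nat -> X -> X) : Prop :=
  forall (x0 : X) (eps : R), 0 < eps -> exists2 delta : R, 0 < delta &
    forall y : X, mdist y x0 < delta ->
    forall n : nat, (0 < n)%N ->
      mdist (orbit_map phi n x0) (orbit_map phi n y) < eps.

Definition aleph0_expansive (R : realType) (X : metricType R)
    (phi : nat -> X -> X) : Prop :=
  exists2 c : R, 0 < c & forall x : X,
    countable [set y : X | forall i : nat, (0 < i)%N ->
      mdist (orbit_map phi i x) (orbit_map phi i y) <= c].

(* Main.v *)
(* Equicontinuity at x puts a neighbourhood of x inside the countable set of
   points whose orbits stay c-close to that of x, so X is covered by countable
   open sets; a countable subcover would make X countable. *)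
Require Import Defs.
From mathcomp Require Import all_boot all_order all_algebra.
From mathcomp Require Import all_classical all_reals all_analysis.

Local Open Scope classical_set_scope.
Local Open Scope ring_scope.

(** A countable subcover by countable open sets exhibits [X] as a countable union of countable
    sets. *)
Lemma lindelof_locally_countable (X : topologicalType) :
  lindelof_space X ->
  (forall x : X, exists2 A : set X, nbhs x A & countable A) ->
  countable [set: X].
Proof.
move=> lindX loc.
(* Covering by all countable open sets avoids choosing one neighbourhood per point. *)
have [|| V [VU cV <-]] := lindX [set A | open A /\ countable A].
- by move=> A [].
- apply/seteqP; split=> // x _.
  have [A xA cA] := loc x.
  exists (interior A) => //; split; first exact: open_interior.
  exact: sub_countable (subset_card_le (@interior_subset _ A)) cA.
- by apply: bigcup_countable => // A /VU [].
Qed.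

Theorem theorem3p11 (R : realType) (X : metricType R) (phi : nat -> X -> X) :
  ~ countable [set: X] ->
  lindelof_space X ->
  (forall n : nat, (0 < n)%N -> continuous (phi n)) ->
  equicontinuous_system phi ->
  ~ aleph0_expansive phi.
Proof.
move=> ncX lindX _ equi [c c0 cB]; apply: ncX.
apply: lindelof_locally_countable lindX _ => x.
(* The expansivity constant [c] serves as epsilon, so the [delta]-ball at [x] lies in the countable
   set of [cB x]. *)
have [delta delta0 close] := equi x c c0.
eexists; last exact: cB x.
apply/nbhs_ballP; exists delta => //= y.
rewrite ballEmdist /= => xy i i0.
by apply/Order.POrderTheory.ltW/close => //; rewrite metric_sym.
Qed.
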